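(* Let $A\in\mathbb{R}^{d\times d}$ be symmetric and let $b\in\mathbb{R}^d$ with $b\notin\mathrm{Range}(A)$. Let $g$ be the grade of $b$ with respect to $A$. Run the conjugate gradient (CG) iteration on $(A,b)$ started at $x_0=0$, and suppose that no unlucky breakdown occurs. Then, for $1\le k\le g$, one has $Ap_{k-1}=0$ if and only if $k=g$. Furthermore, $p_{g-1}\neq0$.
   Context: Krylov subspace: $\mathcal{K}_k(A,b)=\mathrm{Span}\{b,Ab,\dots,A^{k-1}b\}$, $k\ge 1$. The grade of $b$ with respect to $A$ is the positive integer $g$ with $\dim\mathcal{K}_k(A,b)=k$ for $k\le g$ and $\dim\mathcal{K}_k(A,b)=g$ for $k>g$. CG iteration (in exact arithmetic): $x_0=0$, $r_0=p_0=b$, and for $k=1,2,\dots$, as long as $\langle p_{k-1},Ap_{k-1}\rangle\neq0$ and $r_{k-1}\ne0$: $\alpha_{k-1}=\|r_{k-1}\|^2/\langle p_{k-1},Ap_{k-1}\rangle$, $x_k=x_{k-1}+\alpha_{k-1}p_{k-1}$, $r_k=r_{k-1}-\alpha_{k-1}Ap_{k-1}$, $\beta_{k-1}=\|r_k\|^2/\|r_{k-1}\|^2$, $p_k=r_k+\beta_{k-1}p_{k-1}$. No unlucky breakdown (for CG): if $A$ is indefinite, then no generated direction $p_{k-1}$ is a zero-curvature direction, i.e. there is no generated nonzero $p_{k-1}\notin\mathrm{Null}(A)$ with $\langle p_{k-1},Ap_{k-1}\rangle=0$. *)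

(* Defs.v *)
From HB Require Import structures.
From mathcomp Require Import all_boot all_order all_algebra.
From mathcomp Require Import reals.

Set Implicit Arguments.
Unset Strict Implicit.
Unset Printing Implicit Defensive.

Import Order.TTheory GRing.Theory Num.Theory.
Local Open Scope ring_scope.

Section CG.
Variables (R : realType) (d : nat).
Implicit Types (A : 'M[R]_d) (b u v x : 'cV[R]_d).

Definition dot u v : R := (u^T *m v) 0 0.

(* The Euclidean norm; the norm that MathComp-Analysis puts on matrices is the
   sup norm. *)
Definition enorm u : R := Num.sqrt (dot u u).

Definition in_range A b : Prop := exists x, b = A *m x.

Definition in_null A x : Prop := A *m x = 0.

Definition indefinite A : Prop :=
  (exists u, 0 < dot u (A *m u)) /\ (exists v, dot v (A *m v) < 0).

Definition krylov A b (k : nat) : {vspace 'cV[R]_d} :=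
  <<[seq A ^+ i *m b | i <- iota 0 k]>>%VS.

Definition is_grade A b (g : nat) : Prop :=
  [/\ (0 < g)%N,
      forall k : nat, (1 <= k <= g)%N -> \dim (krylov A b k) = k
    & forall k : nat, (g < k)%N -> \dim (krylov A b k) = g].

Record cg_state := CGState { cg_x : 'cV[R]_d; cg_r : 'cV[R]_d; cg_p : 'cV[R]_d }.

Definition cg_step A (s : cg_state) : option cg_state :=
  let: CGState x r p := s in
  if (dot p (A *m p) != 0) && (r != 0) then
    let alpha := enorm r ^+ 2 / dot p (A *m p) in
    let x' := x + alpha *: p in
    let r' := r - alpha *: (A *m p) in
    let beta := enorm r' ^+ 2 / enorm r ^+ 2 in
    Some (CGState x' r' (r' + beta *: p))
  else None.

(* [cg_iter A b k = Some s] means that the iterates x_k, r_k, p_k are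
   generated and are the components of s; [cg_iter A b k = None] means that
   the iteration has stopped before producing them. *)
Fixpoint cg_iter A b (k : nat) : option cg_state :=
  if k is k'.+1 then obind (cg_step A) (cg_iter A b k')
  else Some (CGState 0 b b).

Definition no_unlucky_breakdown A b : Prop :=
  indefinite A ->
  ~ exists (k : nat) (s : cg_state),
      [/\ cg_iter A b k = Some s, cg_p s <> 0, ~ in_null A (cg_p s)
        & dot (cg_p s) (A *m cg_p s) = 0].

End CG.

(* Main.v *)
Require Import Defs.
From HB Require Import structures.
From mathcomp Require Import all_boot all_order all_algebra.
From mathcomp Require Import reals.
From mathcomp Require Import ring lra.

Set Implicit Arguments.
Unset Strict Implicit.
Unset Printing Implicit Defensive.

Import Order.TTheory GRing.Theory Num.Theory.
Local Open Scope ring_scope.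

(** Every residual lies in [b + Range A], and every direction is a linear
combination of [b] with coefficient at least 1, plus a vector of [Range A],
because the coefficients [beta] are nonnegative. As [b] is not in [Range A],
residuals and directions never vanish ([residual_neq0], [direction_neq0]), so
that the iteration can only stop at a zero curvature [dot p (A *m p) = 0]. If
[A *m p] were nonzero there, moving from [p] to either side along [A *m p]
would give both signs of curvature ([indefinite_of_zero_curvature]), and [p]
would be an unlucky breakdown. Thus the iteration goes on exactly as long as
[A *m p != 0].

The index at which it stops is found by comparison with the Krylov spaces
[K_k]. The classical orthogonality relations ([cg_invariant]) put the direction
[p_k] in [K_(k+1)] but not in [K_k], so that [K_(k+1) = K_k + <[p_k]>].

- If [A *m p_k = 0], then [A] maps [K_(k+1)] into itself, the Krylov spaces no
  longer grow, and [g <= k + 1] ([grade_le_of_null_direction]).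
- The residual [r_g], if generated, would be a nonzero vector of
  [K_(g+1) = K_g] orthogonal to [K_g], which is absurd. Hence the iteration
  does not pass [p_(g-1)] ([cg_iter_grade]), and [A *m p_(g-1) = 0]. *)

(** * The Euclidean inner product *)

Section DotProduct.
Variables (R : realType) (d : nat).
Implicit Types (A : 'M[R]_d) (u v w : 'cV[R]_d) (a : R).

Lemma dotE u v : dot u v = \sum_i u i 0 * v i 0.
Proof. by rewrite /dot mxE; apply: eq_bigr => i _; rewrite mxE. Qed.

Lemma dotC u v : dot u v = dot v u.
Proof. by rewrite !dotE; apply: eq_bigr => i _; rewrite mulrC. Qed.

Lemma dotDr u v w : dot u (v + w) = dot u v + dot u w.
Proof. by rewrite /dot mulmxDr mxE. Qed.

Lemma dotZr a u v : dot u (a *: v) = a * dot u v.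
Proof. by rewrite /dot -scalemxAr mxE. Qed.

Lemma dotDl u v w : dot (u + v) w = dot u w + dot v w.
Proof. by rewrite dotC dotDr !(dotC w). Qed.

Lemma dotZl a u v : dot (a *: u) v = a * dot u v.
Proof. by rewrite dotC dotZr dotC. Qed.

Lemma dotBr u v w : dot u (v - w) = dot u v - dot u w.
Proof. by rewrite -scaleN1r dotDr dotZr mulN1r. Qed.

Lemma dot_ge0 u : 0 <= dot u u.
Proof. by rewrite dotE; apply: sumr_ge0 => i _; rewrite -expr2 sqr_ge0. Qed.

Lemma dot_eq0 u : (dot u u == 0) = (u == 0).
Proof.
apply/eqP/eqP => [|->]; last first.
  by rewrite dotE big1 // => i _; rewrite mxE mul0r.
move/eqP; rewrite dotE psumr_eq0 => [/allP u0|i _]; last by rewrite -expr2 sqr_ge0.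
apply/matrixP => i j; rewrite (ord1 j) !mxE; apply/eqP.
by have := u0 i (mem_index_enum i); rewrite /= -expr2 sqrf_eq0.
Qed.

Lemma enorm_sqr u : enorm u ^+ 2 = dot u u.
Proof. by rewrite /enorm sqr_sqrtr ?dot_ge0. Qed.

Lemma dot_sym_mx A u v : A^T = A -> dot u (A *m v) = dot (A *m u) v.
Proof. by move=> A_sym; rewrite /dot trmx_mul A_sym mulmxA. Qed.

(** With [v := A *m u], the curvature along [u + t *: v] is
[t * (2 * dot v v + t * dot v (A *m v))], which has the sign of [t] when [t] is
small. *)
Lemma indefinite_of_zero_curvature A u :
  A^T = A -> dot u (A *m u) = 0 -> A *m u != 0 -> indefinite A.
Proof.
move=> A_sym u0 Au_neq0; set v := A *m u; set n := dot v v; set w := dot v (A *m v).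
have n_gt0 : 0 < n by rewrite lt_def dot_ge0 dot_eq0 Au_neq0.
have curv t : dot (u + t *: v) (A *m (u + t *: v)) = t * (2 * n + t * w).
  rewrite mulmxDr -scalemxAr !(dotDl, dotDr, dotZl, dotZr) u0.
  rewrite [dot u (A *m v)]dot_sym_mx // -/v -/n -/w.
  by ring.
have w1_gt0 : 0 < 1 + `|w| by rewrite ltr_pwDl.
(* With this [t], [`|t * w|] is at most [n], so that [2 * n] dominates for both
   [t] and [- t]; the 1 avoids a division by zero. *)
pose t := n / (1 + `|w|).
have t_gt0 : 0 < t by rewrite divr_gt0.
have : `|t * w| <= n.
  rewrite normrM gtr0_norm // /t mulrAC ler_pdivrMr // ler_pM2l //.
  by rewrite lerDr.
rewrite ler_norml => /andP[tw_ge tw_le]; split.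
  exists (u + t *: v); rewrite curv mulr_gt0 //; lra.
exists (u + (- t) *: v); rewrite curv mulNr oppr_lt0 mulr_gt0 //; lra.
Qed.

End DotProduct.

(** * Growth of the Krylov spaces *)

Section Krylov.
Variables (R : realType) (d : nat) (A : 'M[R]_d) (b : 'cV[R]_d).
Implicit Types (u : 'cV[R]_d) (k : nat).

Lemma krylov0 : krylov A b 0 = 0%VS.
Proof. exact: span_nil. Qed.

Lemma krylovS k : krylov A b k.+1 = (krylov A b k + <[A ^+ k *m b]>)%VS.
Proof. by rewrite /krylov -(addn1 k) iotaD map_cat span_cat /= span_seq1. Qed.

Lemma krylov_subS k : (krylov A b k <= krylov A b k.+1)%VS.
Proof. by rewrite krylovS addvSl. Qed.

Lemma mulmx_krylov k u : u \in krylov A b k -> A *m u \in krylov A b k.+1.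
Proof.
elim: k u => [|k IHk] u.
  by rewrite krylov0 memv0 => /eqP->; rewrite mulmx0 mem0v.
rewrite {1}krylovS => /memv_addP[w wK [_ /vlineP[c ->] ->]].
rewrite krylovS mulmxDr memv_add ?IHk //.
by rewrite -scalemxAr memvZ // mulmxA exprS memv_line.
Qed.

(** Since [K_(k+1)] is [K_k] plus one line, any vector gained at this step can
replace [A ^+ k *m b] as its generator. *)
Lemma krylovS_line k u : u \in krylov A b k.+1 -> u \notin krylov A b k ->
  krylov A b k.+1 = (krylov A b k + <[u]>)%VS.
Proof.
move=> uS uN; apply/eqP; rewrite eqEsubv; apply/andP; split; last first.
  by rewrite subv_add krylov_subS -memvE.
rewrite [X in (X <= _)%VS]krylovS subv_add addvSl /= -memvE.
move: uS; rewrite krylovS => /memv_addP[w wK [_ /vlineP[c ->] uE]].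
have c_neq0 : c != 0.
  by apply: contraNneq uN => c0; rewrite uE c0 scale0r addr0.
have -> : A ^+ k *m b = c^-1 *: (u - w).
  by rewrite uE [w + _]addrC addrK scalerK.
rewrite memvZ // memvB //; last by rewrite (subvP (addvSl _ _)).
by rewrite (subvP (addvSr _ _)) // memv_line.
Qed.

(** The new generator [u] of [K_(k+1)] is killed by [A], so [A] sends [K_(k+1)]
where it sends [K_k], which is back into [K_(k+1)]. *)
Lemma krylov_stationary k u : u \in krylov A b k.+1 -> u \notin krylov A b k ->
  A *m u = 0 -> krylov A b k.+2 = krylov A b k.+1.
Proof.
move=> uS uN Au0; apply/eqP; rewrite eqEsubv krylov_subS andbT.
rewrite krylovS subv_add subvv /= -memvE.
have : A ^+ k *m b \in krylov A b k.+1.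
  by rewrite krylovS (subvP (addvSr _ _)) ?memv_line.
rewrite (krylovS_line uS uN) => /memv_addP[w wK [_ /vlineP[c ->] bE]].
rewrite -(krylovS_line uS uN) exprS -mulmxA bE.
by rewrite mulmxDr -scalemxAr Au0 scaler0 addr0 mulmx_krylov.
Qed.

End Krylov.

(** * Orthogonality relations of the iterates *)

Section ConjugateGradient.
Variables (R : realType) (d : nat) (A : 'M[R]_d) (b : 'cV[R]_d).
Hypotheses (A_sym : A^T = A) (b_range : ~ in_range A b).
Implicit Types (s : cg_state R d) (k : nat).

(** The properties of [r_k] and [p_k] that an iteration step preserves.
Orthogonality is stated against the whole of [K_k] instead of the earlier
residuals and directions, so that no history of the iteration is needed. The
bound [1 <= c] survives the update [p_(k+1) = r_(k+1) + beta *: p_k] because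
[beta >= 0], and serves to exclude [c = 0]. *)
Record cg_invariant k s : Prop := CGInvariant {
  residual_affine : exists y, cg_r s = b + A *m y;
  direction_affine : exists2 c, 1 <= c & exists y, cg_p s = c *: b + A *m y;
  residual_krylov : cg_r s \in krylov A b k.+1;
  direction_residual : cg_p s - cg_r s \in krylov A b k;
  residual_orthogonal : forall u, u \in krylov A b k -> dot u (cg_r s) = 0;
  direction_conjugate :
    forall u, u \in krylov A b k -> dot u (A *m cg_p s) = 0 }.

Lemma not_in_range_affine c y : c != 0 -> c *: b + A *m y != 0.
Proof.
move=> c_neq0; apply/eqP => /eqP; rewrite addr_eq0 => /eqP cbE.
apply: b_range; exists (c^-1 *: - y).
by rewrite -scalemxAr mulmxN -cbE scalerK.
Qed.

Section Invariant.
Variables (k : nat) (s : cg_state R d).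
Hypothesis s_inv : cg_invariant k s.

Lemma residual_neq0 : cg_r s != 0.
Proof.
have [y ->] := residual_affine s_inv.
by rewrite -[b]scale1r not_in_range_affine ?oner_neq0.
Qed.

Lemma direction_neq0 : cg_p s != 0.
Proof.
have [c c_ge1 [y ->]] := direction_affine s_inv.
by rewrite not_in_range_affine // gt_eqF // (lt_le_trans ltr01).
Qed.

(** A vector of [K_k] orthogonal to [K_k] is orthogonal to itself, hence zero. *)
Lemma residual_notin : cg_r s \notin krylov A b k.
Proof.
apply: contra residual_neq0 => rK.
by rewrite -dot_eq0 (residual_orthogonal s_inv).
Qed.

Lemma direction_krylov : cg_p s \in krylov A b k.+1.
Proof.
rewrite -[cg_p s](subrK (cg_r s)) memvD ?(residual_krylov s_inv) //.
by rewrite (subvP (krylov_subS _ _ _)) ?(direction_residual s_inv).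
Qed.

Lemma direction_notin : cg_p s \notin krylov A b k.
Proof.
apply: contra residual_notin => pK.
by rewrite -[cg_r s](subKr (cg_p s)) memvB ?(direction_residual s_inv).
Qed.

Lemma dot_direction_residual : dot (cg_p s) (cg_r s) = dot (cg_r s) (cg_r s).
Proof.
have -> : cg_p s = (cg_p s - cg_r s) + cg_r s by rewrite subrK.
by rewrite dotDl (residual_orthogonal s_inv (direction_residual s_inv)) add0r.
Qed.

(** As [p_k] generates [K_(k+1)] over [K_k], the relations that the next iterates
satisfy on [K_(k+1)] follow from those on [K_k] and the one at [p_k]. *)
Lemma krylovS_ind (P : 'cV[R]_d -> Prop) :
  (forall w c, w \in krylov A b k -> P (w + c *: cg_p s)) ->
  forall u, u \in krylov A b k.+1 -> P u.
Proof.
move=> HP u; rewrite (krylovS_line direction_krylov direction_notin).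
by move=> /memv_addP[w wK [_ /vlineP[c ->] ->]]; apply: HP.
Qed.

End Invariant.

Lemma cg_invariant0 : cg_invariant 0 (CGState 0 b b).
Proof.
split=> /=.
- by exists 0; rewrite mulmx0 addr0.
- by exists 1 => //; exists 0; rewrite mulmx0 addr0 scale1r.
- by rewrite krylovS krylov0 add0v expr0 mul1mx memv_line.
- by rewrite subrr mem0v.
- by move=> u; rewrite krylov0 memv0 => /eqP->; rewrite -(scale0r b) dotZl mul0r.
- by move=> u; rewrite krylov0 memv0 => /eqP->; rewrite -(scale0r b) dotZl mul0r.
Qed.

(** The step length [alpha] is chosen to make the new residual orthogonal to
[p_k], and [beta] to make the new direction conjugate to [p_k]. On [K_k] both
relations are inherited, as [A] maps [K_k] into [K_(k+1)]. *)
Lemma cg_invariantS k s s' :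
  cg_invariant k s -> cg_step A s = Some s' -> cg_invariant k.+1 s'.
Proof.
move=> s_inv.
have := dot_direction_residual s_inv.
have := (direction_krylov s_inv, krylovS_ind s_inv).
case: s s_inv => x r p [/= [y rE] [c c_ge1 [z pE]] rK _ r_orth p_conj].
move=> [pK KS_ind] p_r.
case: ifP => // /andP[pAp_neq0 r_neq0] [<-].
rewrite !enorm_sqr.
set al := dot r r / dot p (A *m p); set r' := r - al *: (A *m p).
set be := dot r' r' / dot r r.
have rr_neq0 : dot r r != 0 by rewrite dot_eq0.
have al_neq0 : al != 0 by rewrite mulf_neq0 ?invr_neq0.
have be_ge0 : 0 <= be by rewrite divr_ge0 ?dot_ge0.
have r'_orth u : u \in krylov A b k.+1 -> dot u r' = 0.
  move: u; apply: KS_ind => w e wK.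
  rewrite dotDl dotZl !dotBr !dotZr r_orth // p_conj // p_r.
  by rewrite /al divfK // subrr mulr0 subr0 mulr0 addr0.
have [y' r'E] : exists y', r' = b + A *m y'.
  by exists (y - al *: p); rewrite mulmxBr -scalemxAr addrA -rE.
split=> /=.
- by exists y'.
- exists (1 + be * c); first by rewrite lerDl mulr_ge0 // (le_trans ler01).
  exists (y' + be *: z).
  by rewrite r'E pE scalerDr scalerA addrACA mulmxDr scalemxAr scalerDl scale1r.
- rewrite memvB ?memvZ ?mulmx_krylov //.
  by rewrite (subvP (krylov_subS _ _ _)).
- by rewrite [r' + _]addrC addrK memvZ.
- exact: r'_orth.
- apply: KS_ind => w e wK.
  (* Reading [A *m p] off the residual update turns conjugacy to [p] into the
     orthogonality of the two successive residuals. *)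
  have Ap : A *m p = al^-1 *: (r - r').
    by rewrite /r' opprB addrCA subrr addr0 scalerK.
  have ApR : dot (A *m p) r' = - (al^-1 * dot r' r').
    rewrite Ap dotZl dotC dotBr dotC r'_orth // sub0r mulrN //.
  rewrite mulmxDr -scalemxAr dotDl !dotDr !dotZr.
  rewrite p_conj // !dotZl dot_sym_mx // r'_orth ?mulmx_krylov //.
  rewrite dot_sym_mx // ApR /be /al; field.
  by rewrite pAp_neq0 rr_neq0.
Qed.

(** * Where the iteration stops *)

Lemma cg_iter_invariant k s : cg_iter A b k = Some s -> cg_invariant k s.
Proof.
elim: k s => [|k IHk] s /=; first by move=> [<-]; apply: cg_invariant0.
case: (cg_iter A b k) IHk => // s0 /(_ s0 erefl) s0_inv /=.
exact: cg_invariantS.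
Qed.

(** The residual cannot vanish, and a zero curvature with [A *m p_k != 0] would
make [A] indefinite and [p_k] an unlucky breakdown. *)
Lemma cg_iterS k s : no_unlucky_breakdown A b ->
  cg_iter A b k = Some s -> A *m cg_p s != 0 ->
  exists s', cg_iter A b k.+1 = Some s'.
Proof.
move=> no_breakdown sE Ap_neq0.
have s_inv := cg_iter_invariant sE.
have curv_neq0 : dot (cg_p s) (A *m cg_p s) != 0.
  apply/eqP => curv0.
  apply: no_breakdown (indefinite_of_zero_curvature A_sym curv0 Ap_neq0) _.
  exists k, s; split=> //; first exact/eqP/(direction_neq0 s_inv).
  exact/eqP.
have r_neq0 := residual_neq0 s_inv.
rewrite /= sE /=; case: s curv_neq0 r_neq0 {sE s_inv Ap_neq0} => x r p /= -> ->.
by eexists.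
Qed.

(** The vector [p_k] lies in [K_(k+1)] but not in [K_k], so if [A] kills it the
Krylov spaces stop growing at [K_(k+1)]. *)
Lemma grade_le_of_null_direction g k s : is_grade A b g ->
  cg_iter A b k = Some s -> A *m cg_p s = 0 -> (g <= k.+1)%N.
Proof.
move=> [_ dimK _] /cg_iter_invariant s_inv Ap0.
rewrite leqNgt; apply/negP => k_lt.
have := krylov_stationary (direction_krylov s_inv) (direction_notin s_inv) Ap0.
move/(congr1 (fun V : {vspace _} => \dim V)).
rewrite !dimK // ?(ltnW k_lt) // => /eqP.
by rewrite eqn_leq ltnn.
Qed.

(** A residual [r_g] would belong to [K_(g+1)] but not to [K_g], whereas these
spaces coincide. *)
Lemma cg_iter_grade g : is_grade A b g -> cg_iter A b g = None.
Proof.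
move=> [g_gt0 dimK dimK'].
case sE : (cg_iter A b g) => [s|//].
have s_inv := cg_iter_invariant sE.
have /negP[] := residual_notin s_inv.
suff -> : krylov A b g = krylov A b g.+1 by exact: residual_krylov s_inv.
apply/eqP; rewrite eqEdim krylov_subS /= dimK' // dimK //.
by rewrite g_gt0 leqnn.
Qed.

End ConjugateGradient.

Theorem lemma1 (R : realType) (d : nat) (A : 'M[R]_d) (b : 'cV[R]_d) (g : nat)
    (A_sym : A^T = A) (b_range : ~ in_range A b) (g_grade : is_grade A b g)
    (no_breakdown : no_unlucky_breakdown A b) :
  (forall k : nat, (1 <= k <= g)%N ->
     exists2 s : cg_state R d, cg_iter A b k.-1 = Some s &
       (A *m cg_p s = 0 <-> k = g)) /\
  (exists2 s : cg_state R d, cg_iter A b g.-1 = Some s & cg_p s <> 0).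
Proof.
have g_gt0 : (0 < g)%N by case: g_grade.
have gen k : (k < g)%N -> exists s, cg_iter A b k = Some s.
  elim: k => [|k IHk] k_lt; first by eexists.
  have [s sE] := IHk (ltnW k_lt).
  apply: cg_iterS (sE) _ => //; apply/eqP => Ap0.
  have := grade_le_of_null_direction A_sym b_range g_grade sE Ap0.
  by rewrite leqNgt k_lt.
split=> [[//|k] /= k_lt|]; last first.
  have [|s sE] := gen g.-1; first by rewrite prednK.
  exists s => //; apply/eqP.
  exact: (direction_neq0 b_range (cg_iter_invariant A_sym b_range sE)).
have [s sE] := gen k k_lt; exists s => //; split=> [Ap0|kE].
  apply/eqP; rewrite eqn_leq k_lt.
  exact: grade_le_of_null_direction g_grade sE Ap0.
apply/eqP; apply: contraTT isT => Ap_neq0.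
have [s'] := cg_iterS A_sym b_range no_breakdown sE Ap_neq0.
by rewrite kE cg_iter_grade.
Qed.
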